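(* (Clifford correspondence for modular representations.) Let $\mathbb{F}$ be an algebraically closed field of prime characteristic $p$, let $G$ be a finite group and $N \unlhd G$ a normal subgroup such that $p$ divides $|N|$. Let $\sigma\in\hat N$, let $I=I_G(\sigma)$ be its inertia group, and let $\hat I(\sigma)=\{\phi\in\hat I \mid W_\phi\subseteq \mathrm{Ind}^I_N V_\sigma\}$, where $W_\phi$ is the representation space of $\phi$, such that $\mathrm{Ind}^I_N\sigma$ has the decomposition $$\mathrm{Ind}^I_N\sigma\cong\bigoplus_{\phi\in\hat I(\sigma)} m_\phi\,\phi,$$ where $m_\phi$ is the multiplicity of $\phi\in\hat I(\sigma)$. Then the map from $\hat I(\sigma)$ to $\hat G(\sigma)$ defined by $$\phi\mapsto \mathrm{Ind}^G_I\phi$$ is a bijection. Furthermore, for every $\phi\in\hat I(\sigma)$, the inertia index of $\phi$ with respect to $N$, as well as the inertia index of $\mathrm{Ind}^G_I\phi$ with respect to $N$, is equal to $m_\phi$, and $$\mathrm{Res}^I_N\phi\cong m_\phi\,\sigma.$$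
   Context: All representations are finite-dimensional over $\mathbb{F}$. For a finite group $H$, $\hat{H}$ is the set of equivalence classes of irreducible representations of $H$ over $\mathbb{F}$. $V_\sigma$ denotes the space of $\sigma$, and $U_\theta$ the space of $\theta\in\hat G$. For a representation $\rho$ and an integer $m\ge 0$, $m\rho$ denotes the direct sum of $m$ copies of $\rho$. Induced representation: for a subgroup $H\le K$ and a representation $\sigma$ of $H$ on $V_\sigma$, $\mathrm{Ind}^K_H V_\sigma=\{f:K\to V_\sigma \mid f(kh)=\sigma(h^{-1})f(k)\ \forall h\in H, k\in K\}$ with $K$ acting by left translation, $(k\cdot f)(x)=f(k^{-1}x)$. $\mathrm{Res}$ denotes restriction. $\hat{G}(\sigma)=\{\theta\in\hat G \mid V_\sigma \text{ is (isomorphic to) a subrepresentation of } \mathrm{Res}^G_N U_\theta\}$; likewise $W_\phi\subseteq \mathrm{Ind}^I_NV_\sigma$ means that $\phi$ is (isomorphic to) a subrepresentation of $\mathrm{Ind}^I_N\sigma$. For $g\in G$, ${}^g\sigma(n)=\sigma(g^{-1}ng)$ for $n\in N$, and the inertia group is $I_G(\sigma)=\{g\in G\mid {}^g\sigma\sim\sigma\}$, where $\sim$ denotes equivalence of representations; it contains $N$ as a normal subgroup. The inertia index with respect to $N$ of a representation $\tau$ of $G$ (resp. of $I$) is $\dim_{\mathbb F}\mathrm{Hom}_N(\sigma,\mathrm{Res}^G_N\tau)$ (resp. $\dim_{\mathbb F}\mathrm{Hom}_N(\sigma,\mathrm{Res}^I_N\tau)$). *)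

(* Defs.v *)
From HB Require Import structures.
From mathcomp Require Import all_boot all_fingroup all_algebra.
From mathcomp Require Import generic_quotient mxrepresentation character.
From mathcomp Require Import boolp classical_sets functions.

Set Implicit Arguments.
Unset Strict Implicit.
Unset Printing Implicit Defensive.

Import GroupScope GRing.Theory.
Local Open Scope ring_scope.
Local Open Scope quotient_scope.

(* mxrepresentation lets a group act on row vectors on the right:            *)
(* v |-> v *m rG x. A left representation rho corresponds to the right       *)
(* module v . x := rho(x^-1) v, and submodules, homomorphisms, equivalence   *)
(* and induction below are all taken on the side of right modules.           *)

Section Subrepresentation.

Variables (F : fieldType) (gT : finGroupType) (H : {group gT}).

(* rW is isomorphic to a subrepresentation of rV *)
Definition subrepr m (rW : mx_representation F H m)
    n (rV : mx_representation F H n) : Prop :=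
  exists U : 'M[F]_n, exists modU : mxmodule rV U, mx_rsim rW (submod_repr modU).

(* The matrices B that intertwine rV and rW, as a row space of vectorised    *)
(* 'M_(m, n); see rHomP.                                                     *)
Definition rHom m (rV : mx_representation F H m)
    n (rW : mx_representation F H n) : 'M[F]_(m * n) :=
  (\bigcap_(x in H) kermx (lin_mx (mulmx (rV x) \- mulmxr (rW x))))%MS.

Lemma rHomP m (rV : mx_representation F H m)
    n (rW : mx_representation F H n) (B : 'M[F]_(m, n)) :
  reflect {in H, forall x, rV x *m B = B *m rW x} (mxvec B <= rHom rV rW)%MS.
Proof.
apply: (iffP sub_bigcapmxP) => [hB x Hx | hB x Hx].
  have /sub_kermxP := hB x Hx.
  by rewrite mul_vec_lin => /(canRL mxvecK); rewrite linear0 => /eqP;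
     rewrite subr_eq0 => /eqP.
by apply/sub_kermxP; rewrite mul_vec_lin /= hB // subrr linear0.
Qed.

Definition dimHom m (rV : mx_representation F H m)
  n (rW : mx_representation F H n) : nat := \rank (rHom rV rW).

End Subrepresentation.

Section Induction.

Variables (F : fieldType) (gT : finGroupType) (H K : {group gT}).

Section FunctionSpace.

Variable n : nat.

(* A function f : K -> 'rV_n is encoded as an element of 'M_(#|K|, n) whose  *)
(* row gring_index K k is f k. The two maps below send f to x |-> f (g * x)  *)
(* and to x |-> f (x * g).                                                   *)
Definition ltrans (g : gT) : 'M[F]_(#|K|, n) -> 'M[F]_(#|K|, n) :=
  rowsub (fun i => gring_index K (g * enum_val i)%g).
Definition rtrans (g : gT) : 'M[F]_(#|K|, n) -> 'M[F]_(#|K|, n) :=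
  rowsub (fun i => gring_index K (enum_val i * g)%g).


Lemma mul_vec_ltrans g f :
  mxvec f *m lin_mx (ltrans g) = mxvec (ltrans g f).
Proof. exact: mul_vec_lin. Qed.

Lemma row_ltrans g k f : k \in K ->
  row (gring_index K k) (ltrans g f) = row (gring_index K (g * k)) f.
Proof. by move=> Kk; rewrite row_rowsub gring_indexK. Qed.

Lemma row_rtrans g k f : k \in K ->
  row (gring_index K k) (rtrans g f) = row (gring_index K (k * g)) f.
Proof. by move=> Kk; rewrite row_rowsub gring_indexK. Qed.

Lemma gring_rowP (f1 f2 : 'M[F]_(#|K|, n)) :
  {in K, forall k, row (gring_index K k) f1 = row (gring_index K k) f2} ->
  f1 = f2.
Proof.
move=> eqf; apply/row_matrixP=> i.
by rewrite -(gring_valK i) eqf ?enum_valP.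
Qed.

Lemma fun_mx_repr : mx_repr K (fun g => lin_mx (ltrans g)).
Proof.
split=> [|x y Kx Ky]; apply/row_matrixP=> i; rewrite !rowE.
  rewrite mul_rV_lin mulmx1 -[RHS]vec_mxK; congr mxvec.
  by apply: gring_rowP => k Kk; rewrite row_ltrans ?mul1g.
rewrite mulmxA !mul_rV_lin mxvecK; congr mxvec.
by apply: gring_rowP => k Kk; rewrite !row_ltrans ?groupM ?mulgA.
Qed.

Definition fun_repr := MxRepresentation fun_mx_repr.

End FunctionSpace.

Section Induced.

Variables (sHK : H \subset K) (n : nat) (rH : mx_representation F H n).

(* The space of f with f (k * h) = f k . h; see ind_spaceP. *)
Definition ind_space : 'M[F]_(#|K| * n) :=
  (\bigcap_(h in H) kermx (lin_mx (rtrans h \- mulmxr (rH h))))%MS.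

Lemma ind_spaceP (f : 'M[F]_(#|K|, n)) :
  reflect {in K & H, forall k h,
             row (gring_index K (k * h)) f = row (gring_index K k) f *m rH h}
          (mxvec f <= ind_space)%MS.
Proof.
apply: (iffP sub_bigcapmxP) => [hf k h Kk Hh | hf h Hh].
  have /sub_kermxP := hf h Hh.
  rewrite mul_vec_lin => /(canRL mxvecK); rewrite linear0 => /eqP.
  rewrite subr_eq0 => /eqP /(congr1 (row (gring_index K k))) /=.
  by rewrite row_rtrans // row_mul.
apply/sub_kermxP; rewrite mul_vec_lin /=.
suff hfE : rtrans h f = f *m rH h.
  by rewrite -[X in X - _]/(rtrans h f) hfE subrr linear0.
by apply: gring_rowP => k Kk; rewrite row_rtrans // row_mul hf.
Qed.

Lemma ind_space_module : mxmodule (fun_repr n) ind_space.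
Proof.
apply/mxmoduleP=> g Kg; apply/row_subP=> i; rewrite row_mul.
have := row_sub i ind_space; rewrite -[row i _]vec_mxK.
move: (vec_mx _) => f /ind_spaceP hf; rewrite mul_vec_ltrans.
apply/ind_spaceP=> k h Kk Hh; have Kh := fintype.subsetP sHK h Hh.
by rewrite !row_ltrans ?groupM // mulgA; apply: hf; rewrite ?groupM.
Qed.

Definition ind_repr : mx_representation F K (\rank ind_space) :=
  submod_repr ind_space_module.

End Induced.

Lemma ind_repr_rsim (sHK : H \subset K)
    n1 (rH1 : mx_representation F H n1) n2 (rH2 : mx_representation F H n2) :
  mx_rsim rH1 rH2 -> mx_rsim (ind_repr sHK rH1) (ind_repr sHK rH2).
Proof.
case=> B def_n; case: n2 / def_n rH2 B => rH2 B freeB homB.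
have uB : B \in unitmx by rewrite -row_free_unit.
pose L := lin_mx (mulmxr B) : 'M[F]_(#|K| * n1).
pose L' := lin_mx (mulmxr (invmx B)) : 'M[F]_(#|K| * n1).
have LK : L *m L' = 1%:M.
  apply/row_matrixP=> i; rewrite !rowE mulmx1 mulmxA !mul_rV_lin mxvecK /=.
  by rewrite mulmxK // vec_mxK.
have uL : L \in unitmx by case/mulmx1_unit: LK.
have homL g : fun_repr n1 g *m L = L *m fun_repr n1 g.
  apply/row_matrixP=> i; rewrite !rowE !mulmxA !mul_rV_lin !mxvecK /=.
  congr mxvec; exact: mul_rowsub_mx.
have homB' h : h \in H -> rH2 h *m invmx B = invmx B *m rH1 h.
  by move=> Hh; apply: (canRL (mulKmx uB)); rewrite mulmxA -homB // mulmxK.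
have sL : (ind_space rH1 *m L <= ind_space rH2)%MS.
  apply/row_subP=> i; rewrite row_mul.
  have := row_sub i (ind_space rH1); rewrite -[row i _]vec_mxK.
  move: (vec_mx _) => f /ind_spaceP hf; rewrite mul_vec_lin.
  by apply/ind_spaceP=> k h Kk Hh; rewrite !row_mul hf // -!mulmxA homB.
have sL' : (ind_space rH2 *m L' <= ind_space rH1)%MS.
  apply/row_subP=> i; rewrite row_mul.
  have := row_sub i (ind_space rH2); rewrite -[row i _]vec_mxK.
  move: (vec_mx _) => f /ind_spaceP hf; rewrite mul_vec_lin.
  by apply/ind_spaceP=> k h Kk Hh; rewrite !row_mul hf // -!mulmxA homB'.
have rkL : \rank (ind_space rH1) = \rank (ind_space rH2).
  apply/eqP; rewrite eqn_leq -{1}(mxrankMfree _ (_ : row_free L)) ?row_free_unit //.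
  rewrite mxrankS //= -(mxrankMfree _ (_ : row_free L')) ?mxrankS //.
  by rewrite row_free_unit; case/mulmx1_unit: LK.
have sV : (val_submod (1%:M : 'M_(\rank (ind_space rH1))) *m L
             <= ind_space rH2)%MS.
  by apply: submx_trans sL; rewrite submxMr // val_submod1.
exists (in_submod (ind_space rH2) (val_submod 1%:M *m L)) => // [|g Kg].
  rewrite /row_free mxrank_in_submod // mxrankMfree ?row_free_unit //.
  by rewrite val_submod1.
have valJ : val_submod 1%:M *m fun_repr n1 g
            = ind_repr sHK rH1 g *m val_submod (1%:M : 'M_(\rank (ind_space rH1))).
  by rewrite -val_submodE -(val_submodJ (ind_space_module sHK rH1)) // mul1mx.
rewrite -[RHS](in_submodJ (ind_space_module sHK rH2)) // -[in RHS]mulmxA.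
rewrite -homL [in RHS]mulmxA valJ -mulmxA.
by rewrite (in_submodE _ (val_submod _ *m L)) [RHS]in_submodE !mulmxA.
Qed.

End Induction.

Section Inertia.

Variables (F : fieldType) (gT : finGroupType) (N : {group gT}) (n : nat).
Variable sigma : mx_representation F N n.

Section Conjugate.

Variables (g : gT) (nNg : g \in 'N(N)).

Lemma conjg_mx_repr : mx_repr N (fun x => sigma (x ^ g)%g).
Proof.
split=> [|x y Nx Ny]; first by rewrite conj1g repr_mx1.
by rewrite conjMg repr_mxM ?memJ_norm.
Qed.

(* x ^ g = g^-1 * x * g *)
Definition conjg_repr := MxRepresentation conjg_mx_repr.

End Conjugate.

(* The witness nNg holds for every g in G as soon as N <| G. *)
Definition inertia_set (G : {group gT}) : {set gT} :=
  [set g in G | `[< exists nNg : g \in 'N(N), mx_rsim (conjg_repr nNg) sigma >]].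

Lemma inertia_group_set (G : {group gT}) : group_set (inertia_set G).
Proof.
apply/group_setP; split=> [|x y].
  rewrite inE group1; apply/asboolP; exists (group1 _).
  exists 1%:M => // [|x Nx]; first by rewrite row_free_unit unitmx1.
  by rewrite /= conjg1 mulmx1 mul1mx.
rewrite inE => /andP[Gx /asboolP[nNx [B _ freeB homB]]].
rewrite inE => /andP[Gy /asboolP[nNy [C _ freeC homC]]].
rewrite inE groupM //; apply/asboolP; exists (groupM nNx nNy).
exists (C *m B) => // [|z Nz].
  by move: freeB freeC; rewrite !row_free_unit unitmx_mul => -> ->.
have Nzx : (z ^ x)%g \in N by rewrite memJ_norm.
have /= homCz := homC _ Nzx; have /= homBz := homB z Nz.
by rewrite /= conjgM mulmxA homCz -!mulmxA homBz.
Qed.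

Definition inertia G : {group gT} := Group (inertia_group_set G).

Lemma inertia_sub G : inertia G \subset G.
Proof. by apply/fintype.subsetP=> x; rewrite inE => /andP[]. Qed.

Lemma sub_inertia (G : {group gT}) : N <| G -> N \subset inertia G.
Proof.
move=> /andP[sNG nNG]; apply/fintype.subsetP=> x Nx; rewrite inE (fintype.subsetP sNG) //=.
apply/asboolP; exists (fintype.subsetP (normG N) x Nx).
exists (sigma x^-1%g) => // [|z Nz]; first by rewrite row_free_unit repr_mx_unit ?groupV.
by rewrite /= -!repr_mxM ?groupV ?groupJ // conjgE !mulgA mulgK.
Qed.

End Inertia.

Section Classes.

Variables (F : fieldType) (gT : finGroupType) (H : {group gT}).

HB.instance Definition _ := gen_eqMixin (representation F H).
HB.instance Definition _ := gen_choiceMixin (representation F H).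

Definition rsimb (A B : representation F H) : bool := `[< mx_rsim A B >].

Lemma rsimb_refl : reflexive rsimb.
Proof. by move=> A; apply/asboolP; exact: mx_rsim_refl. Qed.
Lemma rsimb_sym : symmetric rsimb.
Proof.
by move=> A B; apply/asboolP/asboolP; exact: mx_rsim_sym.
Qed.
Lemma rsimb_trans : transitive rsimb.
Proof.
move=> B A C /asboolP AB /asboolP BC.
by apply/asboolP; exact: mx_rsim_trans AB BC.
Qed.

Canonical rsimb_equiv := EquivRel rsimb rsimb_refl rsimb_sym rsimb_trans.

Definition rclass := {eq_quot rsimb}.
HB.instance Definition _ := Quotient.on rclass.

Definition class_of (A : representation F H) : rclass := \pi_rclass A.

Lemma class_ofP (A B : representation F H) :
  reflect (mx_rsim A B) (class_of A == class_of B).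
Proof. by rewrite (eqmodE rsimb_equiv); exact: asboolP. Qed.

Lemma class_of_repr (c : rclass) : class_of (repr c) = c.
Proof. exact: reprK. Qed.

End Classes.

Section Clifford.

Variables (F : fieldType) (gT : finGroupType) (N K : {group gT}).
Variables (sNK : N \subset K) (n : nat) (sigma : mx_representation F N n).
Local Open Scope classical_set_scope.

(* The classes of irreducible representations of K whose restriction to N    *)
(* contains sigma.                                                           *)
Definition irr_res : set (rclass F K) :=
  [set class_of theta | theta in
    [set theta : representation F K | mx_irreducible theta /\ subrepr sigma (subg_repr theta sNK)]].

(* The classes of irreducible subrepresentations of the representation of K  *)
(* induced by sigma.                                                         *)
Definition irr_ind : set (rclass F K) :=
  [set class_of phi | phi in
    [set phi : representation F K | mx_irreducible phi /\ subrepr phi (ind_repr sNK sigma)]].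

Definition inertia_index m (tau : mx_representation F K m) : nat :=
  dimHom sigma (subg_repr tau sNK).

Definition ind_class (c : rclass F N) : rclass F K :=
  class_of (Representation (ind_repr sNK (repr c))).

Lemma ind_class_of (A : representation F N) :
  ind_class (class_of A) = class_of (Representation (ind_repr sNK A)).
Proof.
apply/eqP/class_ofP; apply: ind_repr_rsim.
by apply/class_ofP; rewrite class_of_repr.
Qed.

End Clifford.

(* Main.v *)
(** Let W be the sigma-isotypic component of an irreducible representation
    theta of G lying over sigma.  By Clifford's theorem theta is the direct sum
    of the translates of W, the stabiliser of W is I, and W is an irreducible
    I-module whose restriction to N is a multiple of sigma.  Conversely, let
    phi be an irreducible representation of I lying over sigma and U a simple
    submodule of Ind phi.  Evaluation at 1 maps U onto phi, hence identifies
    phi with the sigma-isotypic component of U; so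
    dim U = |G : I| dim phi = dim Ind phi, which shows that Ind phi is
    irreducible with sigma-isotypic component phi.  Finally, if Res phi = e sigma
    then m_phi = dim Hom(phi, Ind sigma) = dim Hom(Res phi, sigma) = e by
    Frobenius reciprocity and Schur's lemma. *)

Require Import Defs.
From mathcomp Require Import all_boot all_fingroup all_algebra.
From mathcomp Require Import generic_quotient mxrepresentation character.
From mathcomp Require Import boolp classical_sets functions.

Set Implicit Arguments.
Unset Strict Implicit.
Unset Printing Implicit Defensive.

Import GRing.Theory.
Local Open Scope ring_scope.

(** [classically] only eliminates into booleans; reflecting [Q] by [asbool] opens it to arbitrary
    propositions. *)
Lemma classically_Prop (P : Type) (Q : Prop) : classically P -> (P -> Q) -> Q.
Proof.
move=> cP PQ; apply/asboolP; apply: cP => p; apply/asboolP; exact: PQ.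
Qed.

(** Plain functions replace representations, so that representations of larger groups can be
    compared on [A] without writing restrictions. *)
Definition intertwines (F : fieldType) (gT : finGroupType) (A : {set gT})
    m (f : gT -> 'M[F]_m) n (g : gT -> 'M[F]_n) (B : 'M[F]_(m, n)) : Prop :=
  {in A, forall x, f x *m B = B *m g x}.

(** * Intertwining matrices and Schur's lemma *)

Section Intertwiners.

Variables (F : fieldType) (gT : finGroupType) (H : {group gT}).

Implicit Types m n k : nat.

Lemma intertwines_mulmx m n k (f : gT -> 'M[F]_m) (g : gT -> 'M[F]_n)
    (h : gT -> 'M[F]_k) B C :
  intertwines H f g B -> intertwines H g h C -> intertwines H f h (B *m C).
Proof. by move=> hB hC x Hx; rewrite mulmxA hB // -!mulmxA hC. Qed.

Lemma intertwinesS (K : {group gT}) m n (f : gT -> 'M[F]_m) (g : gT -> 'M[F]_n) B :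
  H \subset K -> intertwines K f g B -> intertwines H f g B.
Proof. by move=> sHK hB x /(fintype.subsetP sHK); apply: hB. Qed.

Lemma intertwines_row_free m n (rV : mx_representation F H m)
    (rW : mx_representation F H n) B :
  mx_irreducible rV -> intertwines H rV rW B -> B != 0 -> row_free B.
Proof.
case/mx_irrP=> _ irrV hB; apply: contraR; rewrite -kermx_eq0 => nzk.
have modk : mxmodule rV (kermx B).
  apply/mxmoduleP=> x Hx; apply/sub_kermxP.
  by rewrite -mulmxA hB // mulmxA mulmx_ker mul0mx.
have /row_fullP[C CK] := irrV _ modk nzk.
by rewrite -[B]mul1mx -CK -mulmxA mulmx_ker mulmx0.
Qed.

Lemma intertwines_row_full m n (rV : mx_representation F H m)
    (rW : mx_representation F H n) B :
  mx_irreducible rW -> intertwines H rV rW B -> B != 0 -> row_full B.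
Proof.
(* Irreducibility quantifies over square matrices, so the image of [B] enters as [<<B>>]. *)
case/mx_irrP=> _ irrW hB nzB; rewrite /row_full -genmxE; apply: irrW; last first.
  by rewrite -mxrank_eq0 genmxE mxrank_eq0.
rewrite (eqmx_module _ (genmxE _)); apply/mxmoduleP=> x Hx.
by rewrite -hB // submxMl.
Qed.

Lemma intertwines_rsim m n (rV : mx_representation F H m)
    (rW : mx_representation F H n) B :
  mx_irreducible rV -> mx_irreducible rW -> intertwines H rV rW B -> B != 0 ->
  mx_rsim rV rW.
Proof.
move=> irrV irrW hB nzB; have freeB := intertwines_row_free irrV hB nzB.
exists B => //; have := intertwines_row_full irrW hB nzB.
by move: freeB; rewrite /row_free /row_full => /eqP -> /eqP ->.
Qed.

Lemma rsim_intertwines m n (rV : mx_representation F H m)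
    (rW : mx_representation F H n) :
  mx_rsim rV rW -> exists B, exists C, [/\ intertwines H rV rW B,
     intertwines H rW rV C, B *m C = 1%:M & C *m B = 1%:M].
Proof.
case=> B eqmn; case: n / eqmn rW B => rW B; rewrite row_free_unit => uB hB.
exists B, (invmx B); split; rewrite ?mulVmx ?mulmxV // => x Hx.
by apply: (canRL (mulKmx uB)); rewrite mulmxA -hB // mulmxK.
Qed.

Lemma intertwines_submod m n (rV : mx_representation F H m)
    (rW : mx_representation F H n) B :
    intertwines H rV rW B -> row_free B ->
  exists modB : mxmodule rW <<B>>%MS, mx_rsim rV (submod_repr modB).
Proof.
move=> hB freeB.
have modB : mxmodule rW <<B>>%MS.
  rewrite (eqmx_module _ (genmxE _)); apply/mxmoduleP=> x Hx.
  by rewrite -hB // submxMl.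
have sB : (B <= <<B>>)%MS by rewrite genmxE.
exists modB; exists (in_submod <<B>>%MS B) => [||x Hx].
- by rewrite genmxE (eqP freeB).
- by rewrite /row_free mxrank_in_submod.
by rewrite -(in_submodJ modB) // -hB // in_submodE [in RHS]in_submodE mulmxA.
Qed.

Lemma intertwines_val_submod n (rV : mx_representation F H n) (U : 'M_n)
    (modU : mxmodule rV U) :
  intertwines H (submod_repr modU) rV (val_submod (1%:M : 'M_(\rank U))).
Proof.
move=> x Hx; rewrite -(val_submodJ modU) // mul1mx.
by rewrite -val_submodE.
Qed.

Lemma subreprP m n (rW : mx_representation F H m) (rV : mx_representation F H n) :
  subrepr rW rV <-> exists2 B, intertwines H rW rV B & row_free B.
Proof.
split=> [[U [modU /rsim_intertwines[B [C [hB _ BC _]]]]] | [B hB freeB]].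
  exists (B *m val_submod 1%:M).
    exact: intertwines_mulmx hB (intertwines_val_submod modU).
  apply/row_freeP; exists (in_submod U 1%:M *m C).
  by rewrite mulmxA -(mulmxA B) -in_submodE val_submodK mulmx1.
by exists <<B>>%MS; apply: intertwines_submod hB freeB.
Qed.

End Intertwiners.

(** * Frobenius reciprocity and the dimension of induced modules *)

Section Frobenius.

Variables (F : fieldType) (gT : finGroupType) (H K : {group gT}).
Hypothesis sHK : H \subset K.

Section Evaluation.

Variables (n : nat) (rW : mx_representation F H n).

(** The counit of Frobenius reciprocity: row i is the value at 1 of the i-th basis function of the
    induced space. *)
Definition ind_eval1 : 'M[F]_(\rank (ind_space K rW), n) :=
  val_submod 1%:M *m lin1_mx (row (gring_index K 1%g) \o vec_mx).

Lemma mul_ind_eval1 m (B : 'M_(m, _)) i :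
  row i (B *m ind_eval1) =
  row (gring_index K 1%g) (vec_mx (row i (val_submod B))).
Proof. by rewrite mulmxA -val_submodE row_mul mul_rV_lin1. Qed.

(** The action is (f . k)(x) = f(k x), hence f(k) = (f . k)(1). *)
Lemma row_ind_repr m (B : 'M_(m, _)) i k : k \in K ->
  row (gring_index K k) (vec_mx (row i (val_submod B))) =
  row (gring_index K 1%g)
    (vec_mx (row i (val_submod (B *m ind_repr sHK rW k)))).
Proof.
move=> Kk; rewrite (val_submodJ (ind_space_module sHK rW)) // row_mul.
rewrite -{2}[row i _]vec_mxK mul_vec_ltrans mxvecK row_ltrans //.
by rewrite mulg1.
Qed.

(** (f . h)(1) = f(h) = f(1 h) = f(1) . h, the last equality being the condition that defines the
    induced space. *)
Lemma ind_eval1_intertwines : intertwines H (ind_repr sHK rW) rW ind_eval1.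
Proof.
move=> h Hh; apply/row_matrixP=> i; have Kh := fintype.subsetP sHK h Hh.
rewrite [RHS]row_mul mul_ind_eval1 -[ind_repr sHK rW h]mul1mx -row_ind_repr //.
rewrite -[in RHS](mul1mx ind_eval1) mul_ind_eval1.
rewrite -{1}[h]mul1g; set f := vec_mx _.
suff /ind_spaceP->: (mxvec f <= ind_space K rW)%MS by [].
by rewrite vec_mxK (submx_trans (row_sub _ _)) ?val_submodP.
Qed.

(* A function in the induced space is recovered from the values at 1 of its  *)
(* translates.                                                               *)
Lemma ind_eval1_inj m (rV : mx_representation F K m) B :
  intertwines K rV (ind_repr sHK rW) B -> B *m ind_eval1 = 0 -> B = 0.
Proof.
move=> hB B0; apply: (@val_submod_inj _ _ (ind_space K rW)).
rewrite linear0; apply/row_matrixP=> i; rewrite row0 -[LHS]vec_mxK.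
apply: (canLR vec_mxK); rewrite linear0; apply: gring_rowP=> k Kk.
rewrite row_ind_repr // -hB // -mul_ind_eval1 -mulmxA B0 mulmx0.
by rewrite !row0.
Qed.

(** The adjoint of P: a vector v goes to the function k |-> (v . k) P. *)
Definition ind_lift m (rV : mx_representation F K m) (P : 'M[F]_(m, n)) :
    'M[F]_(m, \rank (ind_space K rW)) :=
  in_submod (ind_space K rW)
    (\matrix_(i < m) mxvec (\matrix_(k < #|K|) row i (rV (enum_val k) *m P))).

Section Lift.

Variables (m : nat) (rV : mx_representation F K m) (P : 'M[F]_(m, n)).
Hypothesis hP : intertwines H rV rW P.

Let L : 'M[F]_(m, #|K| * n) :=
  \matrix_(i < m) mxvec (\matrix_(k < #|K|) row i (rV (enum_val k) *m P)).

Let row_L i k : k \in K ->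
  row (gring_index K k) (vec_mx (row i L)) = row i (rV k *m P).
Proof. by move=> Kk; rewrite rowK mxvecK rowK gring_indexK. Qed.

Let L_ind : (L <= ind_space K rW)%MS.
Proof.
apply/row_subP=> i; rewrite -[row i L]vec_mxK; apply/ind_spaceP=> k h Kk Hh.
have Kh := fintype.subsetP sHK h Hh.
by rewrite !row_L ?groupM // -row_mul -!mulmxA -hP // mulmxA repr_mxM.
Qed.

Lemma ind_lift_intertwines :
  intertwines K rV (ind_repr sHK rW) (ind_lift rV P).
Proof.
move=> g Kg; rewrite /ind_lift -/L -(in_submodJ (ind_space_module sHK rW)) //.
rewrite in_submodE mulmxA -in_submodE; congr in_submod.
apply/row_matrixP=> i; rewrite [RHS]row_mul -[row i L]vec_mxK mul_vec_ltrans.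
rewrite -[LHS]vec_mxK; congr mxvec; apply: gring_rowP=> k Kk.
rewrite row_ltrans // row_L ?groupM // repr_mxM //.
(* [row_L] describes single rows of [L], so both sides are expanded over the rows with coefficients
   from [rV g]. *)
rewrite (row_mul i (rV g) L) (mulmx_sum_row (row i (rV g)) L).
rewrite linear_sum linear_sum /=.
rewrite -mulmxA row_mul (mulmx_sum_row (row i (rV g)) (rV k *m P)).
by apply: eq_bigr => j _; rewrite !linearZ /= row_L.
Qed.

Lemma ind_liftK : ind_lift rV P *m ind_eval1 = P.
Proof.
apply/row_matrixP=> i; rewrite mul_ind_eval1 in_submodK //.
by rewrite row_L // repr_mx1 mul1mx.
Qed.

End Lift.

Lemma ind_hom_neq0 m (rV : mx_representation F K m) :
  (exists2 B, intertwines K rV (ind_repr sHK rW) B & B != 0) <->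
  (exists2 B, intertwines H rV rW B & B != 0).
Proof.
split=> [[B hB nzB] | [P hP nzP]].
  exists (B *m ind_eval1).
    exact: intertwines_mulmx (intertwinesS sHK hB) ind_eval1_intertwines.
  by apply: contraNneq nzB => /(ind_eval1_inj hB)->.
exists (ind_lift rV P); first exact: ind_lift_intertwines.
by apply: contraNneq nzP => P0; rewrite -(ind_liftK hP) P0 mul0mx.
Qed.

(** A function in the induced space is determined by its values on one representative of each left
    coset of H in K. *)
Lemma ind_space_rank : (\rank (ind_space K rW) <= #|K : H|%g * n)%N.
Proof.
pose t := #|lcosets H K|.
have r_in (i : 'I_t) : exists2 k, k \in K & fingroup.repr (enum_val i) = k.
  have /lcosetsP[k Kk ->] := enum_valP i; exists (fingroup.repr (k *: H)%g) => //.
  have /lcosetP[h Hh ->] := mem_repr _ (lcoset_refl H k).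
  by rewrite groupM // (fintype.subsetP sHK).
pose L (f : 'M[F]_(#|K|, n)) : 'M[F]_(t, n) :=
  rowsub (fun i : 'I_t => gring_index K (fingroup.repr (enum_val i))) f.
have: (ind_space K rW :&: kermx (lin_mx L))%MS == 0.
  apply/rowV0P=> v; rewrite sub_capmx -{1 2}[v]vec_mxK => /andP[].
  set f := vec_mx v => /ind_spaceP hf /sub_kermxP; rewrite mul_vec_lin.
  move/(canRL mxvecK); rewrite linear0 => Lf0.
  rewrite -[v]vec_mxK -/f; apply: (canLR vec_mxK); rewrite linear0.
  apply: gring_rowP => k Kk.
  have kH : (k *: H)%g \in lcosets H K by apply/lcosetsP; exists k.
  (* The representative of the coset of [k] is [k * h], so vanishing there means f(k) . h = 0, and
     [rW h] is invertible. *)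
  have [h Hh kE] := lcosetP (mem_repr _ (lcoset_refl H k)).
  have := congr1 (row (enum_rank_in kH (k *: H)%g)) Lf0.
  rewrite row_rowsub enum_rankK_in // row0 kE hf // => /(canRL (repr_mxK _ Hh)).
  by rewrite mul0mx row0.
move/mxrank_injP <-; rewrite (leq_trans (rank_leq_col _)) //.
by rewrite /t card_lcosets.
Qed.

(** The witness is supported on H, where it is h |-> u . h for a basis vector u. *)
Lemma ind_space_neq0 : (0 < n)%N -> (0 < \rank (ind_space K rW))%N.
Proof.
move=> n_gt0; rewrite lt0n mxrank_eq0.
pose u : 'rV[F]_n := delta_mx 0 (Ordinal n_gt0).
pose f : 'M[F]_(#|K|, n) :=
  \matrix_i (if enum_val i \in H then u *m rW (enum_val i) else 0).
have fE k : k \in K ->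
  row (gring_index K k) f = if k \in H then u *m rW k else 0.
  by move=> Kk; rewrite rowK gring_indexK.
have: (mxvec f <= ind_space K rW)%MS.
  apply/ind_spaceP=> k h Kk Hh; have Kh := fintype.subsetP sHK h Hh.
  have Kkh := groupM Kk Kh; rewrite !fE // groupMr //.
  case: ifP => Hk; last by rewrite mul0mx.
  by rewrite -mulmxA repr_mxM.
apply: contraTneq => ->; rewrite submx0 mxvec_eq0.
apply/eqP => /(congr1 (row (gring_index K 1%g))); rewrite fE // group1 row0.
rewrite repr_mx1 mulmx1 => /rowP/(_ (Ordinal n_gt0)) /eqP.
by rewrite !mxE !eqxx oner_eq0.
Qed.

End Evaluation.

End Frobenius.

(** * Dimensions of Hom spaces *)

Section DimHom.

Variable F : fieldType.

Lemma mxrank_le_lin m n m' n' p (f : {linear 'M[F]_(m, n) -> 'M[F]_(m', n')})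
    (U : 'M[F]_(p, m * n)) q (V : 'M[F]_(q, m' * n')) :
  (forall B, (mxvec B <= U)%MS -> (mxvec (f B) <= V)%MS) ->
  (forall B, (mxvec B <= U)%MS -> f B = 0 -> B = 0) ->
  (\rank U <= \rank V)%N.
Proof.
move=> sfV injf; have: (U :&: kermx (lin_mx f))%MS == 0.
  apply/rowV0P=> v; rewrite sub_capmx -{1 2 3}[v]vec_mxK => /andP[vU].
  move/sub_kermxP; rewrite mul_vec_lin => /(canRL mxvecK); rewrite linear0.
  by move/(injf _ vU) => ->; rewrite linear0.
move/mxrank_injP <-; apply: mxrankS; apply/row_subP=> i.
rewrite row_mul -[row i U]vec_mxK mul_vec_lin; apply: sfV.
by rewrite vec_mxK row_sub.
Qed.

Variable gT : finGroupType.

Lemma dimHom_le (H K : {group gT}) m (rV : mx_representation F H m)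
    n (rW : mx_representation F H n) m' (rV' : mx_representation F K m')
    n' (rW' : mx_representation F K n')
    (f : {linear 'M[F]_(m, n) -> 'M[F]_(m', n')}) :
  (forall B, intertwines H rV rW B -> intertwines K rV' rW' (f B)) ->
  (forall B, intertwines H rV rW B -> f B = 0 -> B = 0) ->
  (dimHom rV rW <= dimHom rV' rW')%N.
Proof.
move=> hf injf; apply: (mxrank_le_lin (f := f)) => B /rHomP hB.
  by apply/rHomP; apply: hf.
exact: injf.
Qed.

Variable H : {group gT}.

Lemma dimHom_gt0P m (rV : mx_representation F H m)
    n (rW : mx_representation F H n) :
  (0 < dimHom rV rW)%N <-> exists2 B, intertwines H rV rW B & B != 0.
Proof.
rewrite lt0n mxrank_eq0; split=> [/rowV0Pn[v vU nzv] | [B /rHomP hB nzB]].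
  exists (vec_mx v); first by apply/rHomP; rewrite vec_mxK.
  by rewrite vec_mx_eq0.
apply/rowV0Pn; exists (mxvec B) => //; by rewrite mxvec_eq0.
Qed.

Lemma dimHom_rsim m m' (rV : mx_representation F H m)
    (rV' : mx_representation F H m') n n' (rW : mx_representation F H n)
    (rW' : mx_representation F H n') :
  mx_rsim rV rV' -> mx_rsim rW rW' -> dimHom rV rW = dimHom rV' rW'.
Proof.
move=> simV simW; apply/eqP; rewrite eqn_leq.
wlog suff IH: m m' rV rV' n n' rW rW' simV simW /
    (dimHom rV rW <= dimHom rV' rW')%N.
  by rewrite !IH //; apply: mx_rsim_sym.
have [P [P' [hP hP' PP' P'P]]] := rsim_intertwines simV.
have [Q [Q' [hQ hQ' QQ' Q'Q]]] := rsim_intertwines simW.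
apply: (dimHom_le (f := mulmx P' \o mulmxr Q)) => B hB /=.
  apply: intertwines_mulmx hP' _; exact: intertwines_mulmx hB hQ.
move/(congr1 (mulmx P)); rewrite mulmxA PP' mul1mx mulmx0.
by move/(congr1 (mulmxr Q')); rewrite /= -mulmxA QQ' mulmx1 mul0mx.
Qed.

Lemma intertwines_dadd_r m (rV : mx_representation F H m)
    (rA rB : representation F H) X :
  intertwines H rV (dadd_grepr rA rB) X <->
  intertwines H rV rA (lsubmx X) /\ intertwines H rV rB (rsubmx X).
Proof.
suff hX x : (rV x *m X = X *m dadd_grepr rA rB x) <->
    rV x *m lsubmx X = lsubmx X *m rA x /\ rV x *m rsubmx X = rsubmx X *m rB x.
  split=> [hX' | [hl hr] x Hx]; last by apply/hX; split; [apply: hl|apply: hr].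
  by split=> x Hx; have /hX[] := hX' x Hx.
rewrite -{1 2}[X]hsubmxK mul_mx_row mul_row_block !mulmx0 addr0 add0r.
by split=> [/eq_row_mx|[-> ->]].
Qed.

Lemma intertwines_dadd_l n (rW : mx_representation F H n)
    (rA rB : representation F H) X :
  intertwines H (dadd_grepr rA rB) rW X <->
  intertwines H rA rW (usubmx X) /\ intertwines H rB rW (dsubmx X).
Proof.
suff hX x : (dadd_grepr rA rB x *m X = X *m rW x) <->
    rA x *m usubmx X = usubmx X *m rW x /\ rB x *m dsubmx X = dsubmx X *m rW x.
  split=> [hX' | [hl hr] x Hx]; last by apply/hX; split; [apply: hl|apply: hr].
  by split=> x Hx; have /hX[] := hX' x Hx.
rewrite -{1 2}[X]vsubmxK !mul_col_mx !mul_row_col !mul0mx addr0 add0r.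
by split=> [/eq_col_mx|[-> ->]].
Qed.

(** Rank and nullity of the map [lsubmx] on the Hom space: its image is Hom(V, A), and [rsubmx]
    identifies its kernel with Hom(V, B). *)
Lemma dimHom_dadd_r m (rV : mx_representation F H m)
    (rA rB : representation F H) :
  dimHom rV (dadd_grepr rA rB) = (dimHom rV rA + dimHom rV rB)%N.
Proof.
pose f := lin_mx (@lsubmx F m (rdegree rA) (rdegree rB)).
rewrite /dimHom -(mxrank_mul_ker _ f); congr (_ + _)%N.
  apply/eqmx_rank/andP; split; apply/row_subP=> i.
    rewrite row_mul -[row i _]vec_mxK mul_vec_lin; apply/rHomP.
    have /rHomP/intertwines_dadd_r[] // : (mxvec (vec_mx (row i
      (rHom rV (dadd_grepr rA rB)))) <= rHom rV (dadd_grepr rA rB))%MS.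
    by rewrite vec_mxK row_sub.
  rewrite -[row i _]vec_mxK; set Y := vec_mx _.
  have -> : mxvec Y = mxvec (row_mx Y 0) *m f by rewrite mul_vec_lin /= row_mxKl.
  apply: submxMr; apply/rHomP/intertwines_dadd_r; rewrite row_mxKl row_mxKr.
  split; last by move=> x _; rewrite mulmx0 mul0mx.
  by apply/rHomP; rewrite vec_mxK row_sub.
have capP X : (mxvec X <= rHom rV (dadd_grepr rA rB) :&: kermx f)%MS =
   (mxvec X <= rHom rV (dadd_grepr rA rB))%MS && (lsubmx X == 0).
  rewrite sub_capmx; congr (_ && _).
  by rewrite (sameP sub_kermxP eqP) mul_vec_lin mxvec_eq0.
apply/eqP; rewrite eqn_leq; apply/andP; split.
  apply: (mxrank_le_lin (f := @rsubmx F m (rdegree rA) (rdegree rB))) => X.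
    by rewrite capP => /andP[/rHomP/intertwines_dadd_r[_ hX] _]; apply/rHomP.
  by rewrite capP -[in X = 0](hsubmxK X) => /andP[_ /eqP-> ->]; rewrite row_mx0.
pose J : 'M[F]_(rdegree rB, rdegree rA + rdegree rB) := row_mx 0 1%:M.
have JE (X : 'M_(m, rdegree rB)) : X *m J = row_mx 0 X.
  by rewrite mul_mx_row mulmx0 mulmx1.
apply: (mxrank_le_lin (f := mulmxr J)) => X /= /rHomP hX; rewrite JE.
  rewrite capP row_mxKl eqxx andbT.
  apply/rHomP/intertwines_dadd_r; rewrite row_mxKl row_mxKr; split=> // x _.
  by rewrite mulmx0 mul0mx.
by rewrite -[RHS](@row_mx0 F m (rdegree rA) (rdegree rB)) => /eq_row_mx[].
Qed.

(** Dual to [dimHom_dadd_r], with upper and lower blocks in place of left and right ones. *)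
Lemma dimHom_dadd_l n (rW : mx_representation F H n)
    (rA rB : representation F H) :
  dimHom (dadd_grepr rA rB) rW = (dimHom rA rW + dimHom rB rW)%N.
Proof.
pose f := lin_mx (@usubmx F (rdegree rA) (rdegree rB) n).
rewrite /dimHom -(mxrank_mul_ker _ f); congr (_ + _)%N.
  apply/eqmx_rank/andP; split; apply/row_subP=> i.
    rewrite row_mul -[row i _]vec_mxK mul_vec_lin; apply/rHomP.
    have /rHomP/intertwines_dadd_l[] // : (mxvec (vec_mx (row i
      (rHom (dadd_grepr rA rB) rW))) <= rHom (dadd_grepr rA rB) rW)%MS.
    by rewrite vec_mxK row_sub.
  rewrite -[row i _]vec_mxK; set Y := vec_mx _.
  have -> : mxvec Y = mxvec (col_mx Y 0) *m f by rewrite mul_vec_lin /= col_mxKu.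
  apply: submxMr; apply/rHomP/intertwines_dadd_l; rewrite col_mxKu col_mxKd.
  split; last by move=> x _; rewrite mulmx0 mul0mx.
  by apply/rHomP; rewrite vec_mxK row_sub.
have capP X : (mxvec X <= rHom (dadd_grepr rA rB) rW :&: kermx f)%MS =
   (mxvec X <= rHom (dadd_grepr rA rB) rW)%MS && (usubmx X == 0).
  rewrite sub_capmx; congr (_ && _).
  by rewrite (sameP sub_kermxP eqP) mul_vec_lin mxvec_eq0.
apply/eqP; rewrite eqn_leq; apply/andP; split.
  apply: (mxrank_le_lin (f := @dsubmx F (rdegree rA) (rdegree rB) n)) => X.
    by rewrite capP => /andP[/rHomP/intertwines_dadd_l[_ hX] _]; apply/rHomP.
  by rewrite capP -[in X = 0](vsubmxK X) => /andP[_ /eqP-> ->]; rewrite col_mx0.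
pose J : 'M[F]_(rdegree rA + rdegree rB, rdegree rB) := col_mx 0 1%:M.
have JE (X : 'M_(rdegree rB, n)) : J *m X = col_mx 0 X.
  by rewrite mul_col_mx mul0mx mul1mx.
apply: (mxrank_le_lin (f := mulmx J)) => X /= /rHomP hX; rewrite JE.
  rewrite capP col_mxKu eqxx andbT.
  apply/rHomP/intertwines_dadd_l; rewrite col_mxKu col_mxKd; split=> // x _.
  by rewrite mulmx0 mul0mx.
by rewrite -[RHS](@col_mx0 F (rdegree rA) (rdegree rB) n) => /eq_col_mx[].
Qed.

Lemma dimHom_sum_r m (rV : mx_representation F H m) (I : Type) (r : seq I)
    (P : pred I) (rW : I -> representation F H) :
  dimHom rV (\big[@dadd_grepr F gT H/grepr0]_(i <- r | P i) rW i) =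
  (\sum_(i <- r | P i) dimHom rV (rW i))%N.
Proof.
elim/big_rec2: _ => [|i d rB _ <-]; last exact: dimHom_dadd_r.
(* The empty sum has degree 0, so the Hom space lies in a space with m * 0 columns. *)
by apply/eqP; rewrite -leqn0 (leq_trans (rank_leq_col _)) ?muln0.
Qed.

Lemma dimHom_muln_r m (rV : mx_representation F H m)
    (rW : representation F H) e :
  dimHom rV (muln_grepr rW e) = (e * dimHom rV rW)%N.
Proof. by rewrite dimHom_sum_r sum_nat_const card_ord. Qed.

Lemma dimHom_muln_l n (rW : mx_representation F H n)
    (rV : representation F H) e :
  dimHom (muln_grepr rV e) rW = (e * dimHom rV rW)%N.
Proof.
rewrite /muln_grepr -[in RHS](card_ord e) -sum_nat_const.
elim/big_rec2: _ => [|i rB d _ <-]; last exact: dimHom_dadd_l.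
by apply/eqP; rewrite -leqn0 (leq_trans (rank_leq_col _)) ?mul0n.
Qed.

(** Frobenius reciprocity: composition with [ind_eval1] is injective by [ind_eval1_inj] and onto by
    [ind_liftK]. The second inequality bounds the image of this same linear map, which avoids
    proving that [ind_lift] is linear. *)
Lemma dimHom_ind (K : {group gT}) (sHK : H \subset K)
    m (rV : mx_representation F K m) n (rW : mx_representation F H n) :
  dimHom rV (ind_repr sHK rW) = dimHom (subg_repr rV sHK) rW.
Proof.
apply/eqP; rewrite eqn_leq; apply/andP; split.
  apply: (dimHom_le (f := mulmxr (ind_eval1 K rW))) => B hB /=.
    exact: intertwines_mulmx (intertwinesS sHK hB) (ind_eval1_intertwines _ _).
  exact: ind_eval1_inj hB.
apply: leq_trans (mxrankM_maxl _ (lin_mx (mulmxr (ind_eval1 K rW)))).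
apply: mxrankS; apply/row_subP=> i; rewrite -[row i _]vec_mxK.
set P := vec_mx _; have hP : intertwines H rV rW P.
  by apply/(rHomP (subg_repr rV sHK)); rewrite vec_mxK row_sub.
rewrite -[P](ind_liftK sHK hP) -[X in mxvec X]/(mulmxr (ind_eval1 K rW) _).
by rewrite -mul_vec_lin submxMr //; apply/rHomP; apply: ind_lift_intertwines.
Qed.

End DimHom.

Lemma dimHom_irr (F : closedFieldType) (gT : finGroupType) (H : {group gT})
    m (rV : mx_representation F H m) n (rW : mx_representation F H n) :
    mx_irreducible rV -> mx_irreducible rW ->
  dimHom rV rW = `[< mx_rsim rV rW >] :> nat.
Proof.
move=> irrV irrW; case: asboolP => [simVW | nsimVW]; last first.
  apply/eqP; rewrite -leqn0 leqNgt; apply/negP => /dimHom_gt0P[B hB nzB].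
  exact: nsimVW (intertwines_rsim irrV irrW hB nzB).
rewrite -(dimHom_rsim (mx_rsim_refl rV) simVW).
apply/eqP; rewrite eqn_leq andbC; apply/andP; split.
  apply/dimHom_gt0P; exists 1%:M => [x _|]; first by rewrite mulmx1 mul1mx.
  by case: irrV.
(* Algebraic closedness makes [rV] absolutely irreducible; its endomorphisms are scalars, so the
   identity spans the Hom space. *)
have absV := @group_closure_closed_field F gT H m rV irrV.
apply: leq_trans (rank_leq_row (mxvec (1%:M : 'M[F]_m))); apply: mxrankS.
apply/row_subP=> i; rewrite -[row i _]vec_mxK; set B := vec_mx _.
have /rHomP hB : (mxvec B <= rHom rV rV)%MS by rewrite vec_mxK row_sub.
have /is_scalar_mxP[a ->] : is_scalar_mx B.
  apply: (mx_abs_irr_cent_scalar absV); apply/centgmxP=> x Hx.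
  by rewrite hB.
have -> : mxvec a%:M = a *: mxvec (1%:M : 'M[F]_m).
  by rewrite -linearZ scalemx1.
exact: scalemx_sub.
Qed.

(** * Clifford theory: the isotypic component of a restriction to N *)

Section Isotypic.

Variables (F : fieldType) (gT : finGroupType) (N G : {group gT}).
Hypothesis nsNG : (N <| G)%g.
Variables (k : nat) (sigma : mx_representation F N k).
Hypothesis irr_sigma : mx_irreducible sigma.

Local Notation I := (inertia sigma G).
Local Notation sNG := (normal_sub nsNG).
Local Notation sIG := (inertia_sub sigma G).
Local Notation sNI := (sub_inertia sigma nsNG).

(* rW is the sigma-isotypic component of Res_N theta, presented as a retract *)
(* of Res_I theta.                                                           *)
Variant isotypic_component n (theta : mx_representation F G n) : Prop :=
  IsotypicComponent w (rW : mx_representation F I w) e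
    (i : 'M[F]_(w, n)) (p : 'M[F]_(n, w)) of
    mx_irreducible rW & intertwines I rW theta i & intertwines I theta rW p
  & i *m p = 1%:M & (#|G : I|%g * w)%N = n
  & (forall B, intertwines N theta sigma B -> p *m i *m B = B)
  & (forall B, intertwines N sigma theta B -> B *m p *m i = B)
  & mx_rsim (subg_repr rW sNI) (muln_grepr (Representation sigma) e).

Section Restriction.

Variables (n : nat) (theta : mx_representation F G n).
Hypothesis irr_theta : mx_irreducible theta.

Local Notation rN := (subg_repr theta sNG).

(** The translate of the copy [<<A>>] of sigma by [x] affords the conjugate of sigma by x^-1, so it
    is isomorphic to [<<A>>] exactly when x^-1, equivalently x, lies in I. *)
Lemma inertia_iso A (modA : mxmodule rN <<A>>%MS) x :
    intertwines N sigma theta A -> row_free A -> x \in G ->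
  x \in I <-> mx_iso rN <<A>>%MS (<<A>>%MS *m theta x).
Proof.
move=> hA freeA Gx; have nNx := fintype.subsetP (normal_norm nsNG) x Gx.
have nNx' : (x^-1)%g \in 'N(N)%g by rewrite groupV.
have [modA' simA] := intertwines_submod (rW := rN) hA freeA.
have hAx : intertwines N (conjg_repr sigma nNx') rN (A *m theta x).
  move=> y Ny; have Gy := fintype.subsetP sNG y Ny.
  rewrite /= mulmxA hA ?memJ_norm //.
  have Gyx : (y ^ x^-1)%g \in G by rewrite groupJ ?groupV.
  (* What remains is the group identity (y ^ x^-1) x = x y. *)
  rewrite -!mulmxA -!repr_mxM //; congr (_ *m theta _).
  by rewrite conjgE invgK !mulgA mulgKV.
have freeAx : row_free (A *m theta x).
  by rewrite /row_free mxrankMfree ?repr_mx_free.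
have [modAx simAx] := intertwines_submod hAx freeAx.
have defAx : (<<A *m theta x>> :=: <<A>> *m theta x)%MS.
  by apply: eqmx_trans (genmxE _) (eqmxMr _ (eqmx_sym (genmxE _))).
have isoE : mx_iso rN <<A>>%MS (<<A>>%MS *m theta x) <->
    mx_rsim sigma (conjg_repr sigma nNx').
  split=> [isoA | simC].
    apply: mx_rsim_trans simA (mx_rsim_trans _ (mx_rsim_sym simAx)).
    by apply/mx_rsim_iso/(mx_iso_trans isoA)/eqmx_iso/eqmx_sym.
  apply: mx_iso_trans (eqmx_iso _ defAx); apply/(mx_rsim_iso modA' modAx).
  exact: mx_rsim_trans (mx_rsim_sym simA) (mx_rsim_trans simC simAx).
split=> [Ix | isoA].
  apply/isoE/mx_rsim_sym; have: (x^-1)%g \in I by rewrite groupV.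
  rewrite inE => /andP[_ /asboolP[nNx'' simC]].
  by rewrite (bool_irrelevance nNx' nNx'').
rewrite -groupV inE groupV Gx; apply/asboolP; exists nNx'.
by apply/mx_rsim_sym/isoE.
Qed.

(** Although p may divide |N|, the restriction of theta is a sum of translates of one simple module
    M. A nonzero map to sigma is nonzero on some translate, which Schur's lemma identifies with
    sigma. *)
Lemma Clifford_lies_over :
  (exists2 B, intertwines N theta sigma B & B != 0) ->
  (exists2 A, intertwines N sigma theta A & A != 0).
Proof.
case=> B hB nzB; have [_ nz1 _] := irr_theta.
apply: classically_Prop (mxsimple_exists (mxmodule1 rN) nz1) _ => -[M simM _].
have [X /fintype.subsetP sXG /= [defX _]] := Clifford_basis irr_theta simM.
have [x Xx nzMB] : exists2 x, x \in X & M *m theta x *m B != 0.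
  apply: contrapT => noX; case/negP: nzB; rewrite -[B]mul1mx -submx0.
  rewrite -(eqmxMr B defX) sumsmxMr_gen; apply/sumsmx_subP=> x Xx.
  rewrite genmxE submx0; apply: contrapT => /negP nz; apply: noX; by exists x.
have simMx := Clifford_simple simM (sXG x Xx); set Mx := M *m theta x in nzMB simMx.
have [modMx nzMx _] := simMx.
have hv : intertwines N (submod_repr modMx) sigma (val_submod 1%:M *m B).
  exact: intertwines_mulmx (intertwines_val_submod modMx) hB.
have nzv : val_submod (1%:M : 'M_(\rank Mx)) *m B != 0.
  by apply: contraNneq nzMB => v0; rewrite -submx0 -(eqmxMr B (val_submod1 Mx)) v0 sub0mx.
have irrMx : mx_irreducible (submod_repr modMx) by apply/submod_mx_irr.
have [C [C' [_ hC' _ C'C]]] :=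
  rsim_intertwines (intertwines_rsim irrMx irr_sigma hv nzv).
exists (C' *m val_submod 1%:M).
  exact: intertwines_mulmx hC' (intertwines_val_submod modMx).
rewrite -val_submodE val_submod_eq0; have [_ nzk _] := irr_sigma.
by apply: contraNneq nzk => C'0; rewrite -C'C C'0 mul0mx.
Qed.

(** If x stabilises W, the translate of [<<A>>] is a simple submodule of W, hence isomorphic to
    [<<A>>]; conversely isomorphic simple modules have the same component. [inertia_iso] reads both
    as membership in I. *)
Lemma inertia_eq_rstabs (sH : socleType rN) (W : sH) A :
    intertwines N sigma theta A -> row_free A -> W = component_mx rN <<A>>%MS :> 'M_n ->
  rstabs theta W = I.
Proof.
move=> hA freeA defW; have [modA simA] := intertwines_submod (rW := rN) hA freeA.
have simpleA : mxsimple rN <<A>>%MS.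
  by apply/(submod_mx_irr modA); apply: mx_rsim_irr simA irr_sigma.
apply/setP=> x; case Gx: (x \in G); last first.
  by rewrite !inE Gx.
rewrite inE Gx /=; apply/idP/idP => [sWx | Ix].
  apply/(inertia_iso modA hA freeA Gx).
  refine (component_mx_iso simpleA (Clifford_simple simpleA Gx) _).
  rewrite -defW; apply: submx_trans sWx.
  by rewrite submxMr // defW component_mx_id.
have isoA := (inertia_iso modA hA freeA Gx).1 Ix.
rewrite defW -(Clifford_componentJ simpleA Gx).
have /eqP <- // : component_mx rN <<A>>%MS == component_mx rN (<<A>>%MS *m theta x).
by apply/component_mx_isoP; rewrite //; apply: Clifford_simple.
Qed.

Lemma intertwines_sub_component A B :
    intertwines N sigma theta A -> row_free A -> intertwines N sigma theta B ->
  (B <= component_mx rN <<A>>)%MS.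
Proof.
move=> hA freeA hB; have [-> | nzB] := eqVneq B 0; first exact: sub0mx.
have [modA simA] := intertwines_submod (rW := rN) hA freeA.
have freeB : row_free B.
  exact: (@intertwines_row_free _ _ _ _ _ sigma rN).
have [modB simB] := intertwines_submod (rW := rN) hB freeB.
have simpleA : mxsimple rN <<A>>%MS.
  by apply/(submod_mx_irr modA); apply: mx_rsim_irr simA irr_sigma.
rewrite -genmxE; apply: mx_iso_component => //.
by apply/(mx_rsim_iso modA modB); apply: mx_rsim_trans (mx_rsim_sym simA) simB.
Qed.

(** The retraction is the projection onto the component W along the sum C of the other components;
    it is I-linear because I fixes W and permutes the others. *)
Lemma isotypic_component_exists :
  (exists2 A, intertwines N sigma theta A & A != 0) -> isotypic_component theta.
Proof.
case=> A hA nzA; apply: classically_Prop (socle_exists rN) _ => sH.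
have freeA : row_free A by exact: (@intertwines_row_free _ _ _ _ _ sigma rN).
have [modA simA] := intertwines_submod (rW := rN) hA freeA.
have simpleA : mxsimple rN <<A>>%MS.
  by apply/(submod_mx_irr modA); apply: mx_rsim_irr simA irr_sigma.
pose W := PackSocle (component_socle sH simpleA).
have defW : W = component_mx rN <<A>>%MS :> 'M_n by rewrite PackSocleK.
have stabW := inertia_eq_rstabs hA freeA defW.
pose rI := subg_repr theta sIG.
have simpleW : mxsimple rI W.
  have := Clifford_rstabs_simple irr_theta W.
  move: (rstabs_sub theta W); rewrite -[rstabs theta W]/(gval (rstabs_group theta W)).
  have -> : rstabs_group theta W = I by apply: group_inj.
  by move=> sIG'; rewrite (bool_irrelevance sIG' sIG).
have [modW _ _] := simpleW.
pose C := (\sum_(V : sH | V != W) V)%MS.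
have actW x V : x \in I -> V != W -> ('Cl%act V x : sH) != W.
  move=> Ix; have Gx := fintype.subsetP sIG x Ix; apply: contraNneq => eqVW.
  apply/eqP/(act_inj 'Cl x); rewrite eqVW; apply/esym.
  have Wx : x \in 'C[W | 'Cl]%g by rewrite Clifford_astab1 stabW.
  exact: astab_act Wx (set11 W).
have modC : mxmodule rI C.
  apply/mxmoduleP=> x Ix; have Gx := fintype.subsetP sIG x Ix.
  rewrite sumsmxMr; apply/sumsmx_subP=> V neVW.
  by rewrite (sumsmx_sup ('Cl%act V x : sH)) ?actW // val_Clifford_act.
have WC1 : (W + C = 1%:M :> 'M_n)%MS.
  by rewrite -(Clifford_Socle1 irr_theta sH) /Socle (bigD1 W).
have dxWC : (W :&: C = 0)%MS.
  by have /mxdirect_sumsP-> := Socle_direct sH.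
pose P := proj_mx W C.
have hP : intertwines I theta theta P.
  have := proj_mx_hom dxWC modW modC; rewrite WC1 => /hom_mxP hP x Ix.
  by have := hP x Ix; rewrite !mul1mx.
have ipP : in_submod W P *m val_submod 1%:M = P.
  by rewrite -val_submodE in_submodK // -[P]mul1mx proj_mx_sub.
have irrW : mx_irreducible (submod_repr modW) by apply/submod_mx_irr.
apply: (@IsotypicComponent _ _ _ (submod_repr modW) (socle_mult W)
  (val_submod 1%:M) (in_submod W P)) => //.
- exact: intertwines_val_submod.
- move=> x Ix; rewrite -(in_submodJ modW); last by rewrite -[P]mul1mx proj_mx_sub.
  by rewrite in_submodE mulmxA hP // -in_submodE.
- rewrite in_submodE mulmxA -in_submodE proj_mx_id ?val_submodP //.
  exact: val_submodK.
(* G permutes the components transitively and W has stabiliser I, so there are |G : I| of them, all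
   of the rank of W. *)
- rewrite -[RHS](Clifford_rank_components irr_theta W); congr (_ * _)%N.
  have trans_sH := Clifford_atrans irr_theta sH.
  rewrite -cardsT -(atransPin (subxx G) trans_sH (finset.in_setT W)).
  rewrite card_orbit_in // Clifford_astab1 stabW.
  by rewrite (finset.setIidPr sIG).
(* For V other than W, the endomorphism [B *m A] maps V into V, as it preserves components, and into
   W, which contains the rows of [A]. Thus it kills V, and so does [B] since [A] is row free. *)
- move=> B hB; have CB0 : C *m B = 0.
    apply/eqP; rewrite -submx0 sumsmxMr_gen; apply/sumsmx_subP=> V neVW.
    rewrite genmxE submx0 -(mulmx_free_eq0 _ freeA) -mulmxA -submx0.
    rewrite -(component_mx_disjoint (socle_simple V) simpleA) -?defW //.
    rewrite sub_capmx; apply/andP; split.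
      refine (hom_component_mx (socle_simple V) _); apply/hom_mxP=> x Nx.
      by rewrite -[rN x]/(theta x) -!mulmxA -hA // !mulmxA
        -(mulmxA _ B (sigma x)) -hB // !mulmxA.
    rewrite defW mulmxA (submx_trans (submxMl _ _)) //.
    by rewrite (submx_trans _ (component_mx_id simpleA)) ?genmxE.
  have PC1 : P + proj_mx C W = 1%:M.
    by have := @add_proj_mx _ _ _ _ _ 1%:M dxWC; rewrite WC1 !mul1mx; apply.
  rewrite ipP -[RHS]mul1mx -PC1 mulmxDl [X in _ + X](_ : _ = 0) ?addr0 //.
  have /submxP[D ->] : (proj_mx C W <= C)%MS by rewrite -[proj_mx _ _]mul1mx proj_mx_sub.
  by rewrite -mulmxA CB0 mulmx0.
- move=> B hB; rewrite -mulmxA ipP proj_mx_id // defW.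
  exact: intertwines_sub_component.
- have isoW : mx_iso rN (socle_base W) <<A>>%MS.
    apply/component_mx_isoP => //; first exact: socle_simple.
    by rewrite -[component_mx _ (socle_base W)]/(socle_val W) defW.
  have simW : mx_rsim (socle_repr W) (Representation sigma).
    apply: mx_rsim_trans (mx_rsim_sym simA).
    exact/(mx_rsim_iso (socle_module W) modA).
  have [D eqD freeD hD] := mx_rsim_socle simW.
  by exists D => // x Nx; rewrite -hD.
Qed.

End Restriction.

End Isotypic.

(** * Induction from the inertia group *)

Section CliffordCorrespondence.

Variables (F : fieldType) (gT : finGroupType) (N G : {group gT}).
Hypothesis nsNG : (N <| G)%g.
Variables (k : nat) (sigma : mx_representation F N k).
Hypothesis irr_sigma : mx_irreducible sigma.

Local Notation I := (inertia sigma G).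
Local Notation sNG := (normal_sub nsNG).
Local Notation sIG := (inertia_sub sigma G).
Local Notation sNI := (sub_inertia sigma nsNG).

(** Phrased by maps onto sigma rather than from it, the side on which Frobenius reciprocity for
    [ind_repr] applies. *)
Definition lies_over m (tau : gT -> 'M[F]_m) : Prop :=
  exists2 B, intertwines N tau sigma B & B != 0.

Lemma inertia_normal : (N <| I)%g.
Proof. exact: normalS sNI sIG nsNG. Qed.

Lemma inertia_id : inertia sigma I = I.
Proof.
apply: group_inj; apply/setP=> x; rewrite inE andb_idr //.
by rewrite inE => /andP[].
Qed.

Lemma lies_over_sub m (phi : mx_representation F I m) :
  mx_irreducible phi -> lies_over phi ->
  exists2 A, intertwines N sigma phi A & A != 0.
Proof. exact: (@Clifford_lies_over _ _ _ _ inertia_normal). Qed.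

(** With I in the role of G the inertia group is all of I and the index is 1, so the isotypic
    component is the whole of phi. *)
Lemma lies_over_multiple m (phi : mx_representation F I m) :
    mx_irreducible phi -> lies_over phi ->
  exists e, mx_rsim (subg_repr phi sNI) (muln_grepr (Representation sigma) e).
Proof.
move=> irr_phi /(lies_over_sub irr_phi).
case/(isotypic_component_exists inertia_normal irr_sigma irr_phi).
move=> w rW e i p _ hi _ ip eqw _ _ simW; exists e.
apply: mx_rsim_trans simW; apply: mx_rsim_sym; exists i.
- by rewrite -eqw inertia_id indexgg mul1n.
- by apply/row_freeP; exists p.
- by move=> x Nx; apply: hi; rewrite inertia_id (fintype.subsetP sNI).
Qed.

(** Projection to the isotypic component does not change N-maps from theta to sigma, nor to phi, a
    multiple of sigma. Hence [B] is nonzero on the component, and Schur's lemma over I identifies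
    the component with phi. *)
Lemma isotypic_component_rsim n (theta : mx_representation F G n)
    m (phi : mx_representation F I m) B :
    mx_irreducible theta -> mx_irreducible phi -> lies_over phi ->
    intertwines I theta phi B -> B != 0 ->
  exists i, exists p, [/\ intertwines I phi theta i, intertwines I theta phi p,
    i *m p = 1%:M, (#|G : I|%g * m)%N = n &
    forall X, intertwines N sigma theta X -> X *m p *m i = X].
Proof.
move=> irr_theta irr_phi phi_sigma hB nzB.
have [C hC nzC] := phi_sigma.
have theta_sigma : exists2 D, intertwines N theta sigma D & D != 0.
  exists (B *m C); first exact: intertwines_mulmx (intertwinesS sNI hB) hC.
  have /row_fullP[B' B'B] :=
    intertwines_row_full (rV := subg_repr theta sIG) irr_phi hB nzB.
  by apply: contraNneq nzC => BC0; rewrite -[C]mul1mx -B'B -mulmxA BC0 mulmx0.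
have [w rW e i p irrW hi hp ip eqw homl homr _] :=
  isotypic_component_exists nsNG irr_sigma irr_theta
    (Clifford_lies_over nsNG irr_sigma irr_theta theta_sigma).
have [f simf] := lies_over_multiple irr_phi phi_sigma.
have hom_phi X : intertwines N theta phi X -> p *m i *m X = X.
  have [Q [Q' [hQ hQ' QQ' Q'Q]]] := rsim_intertwines simf.
  move=> hX; suff : p *m i *m (X *m Q) = X *m Q.
    move/(congr1 (mulmxr Q')); rewrite /= -!mulmxA QQ' mulmx1.
    by rewrite mulmxA.
  have : intertwines N theta (muln_grepr (Representation sigma) f) (X *m Q).
    exact: intertwines_mulmx hX hQ.
  (* The claim is checked on each copy of sigma by induction on the sum; the empty sum leaves a
     matrix without columns. *)
  move: (X *m Q); rewrite /muln_grepr.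
  elim/big_rec: _ => [|j rB _ IH] Y; first by rewrite [Y]thinmx0 mulmx0.
  move/(@intertwines_dadd_r _ _ _ _ (subg_repr theta sNG)) => [/homl hl /IH hr].
  by rewrite -[Y]hsubmxK mul_mx_row hl hr.
have iBB : p *m i *m B = B by apply/hom_phi/(intertwinesS sNI).
have nziB : i *m B != 0.
  by apply: contraNneq nzB => iB0; rewrite -iBB -mulmxA iB0 mulmx0.
have hiB : intertwines I rW phi (i *m B) := intertwines_mulmx hi hB.
have simW := intertwines_rsim irrW irr_phi hiB nziB.
have [Q [Q' [hQ hQ' QQ' Q'Q]]] := rsim_intertwines simW.
exists (Q' *m i), (p *m Q); split.
- exact: intertwines_mulmx hQ' hi.
- exact: intertwines_mulmx hp hQ.
- by rewrite mulmxA -(mulmxA Q') ip mulmx1.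
- by rewrite -(mxrank_rsim simW).
- by move=> X hX; rewrite mulmxA -(mulmxA X) -(mulmxA p) QQ' mulmx1 homr.
Qed.

Lemma ind_irreducible m (phi : mx_representation F I m) :
  mx_irreducible phi -> lies_over phi -> mx_irreducible (ind_repr sIG phi).
Proof.
move=> irr_phi phi_sigma; set R := ind_repr sIG phi.
have [m_gt0 _] := (mx_irrP phi).1 irr_phi.
have nz1 : (1%:M : 'M[F]_(\rank (ind_space G phi))) != 0.
  by rewrite -mxrank_eq0 mxrank1 -lt0n (ind_space_neq0 sIG).
apply: classically_Prop (mxsimple_exists (mxmodule1 R) nz1) _ => -[U simU _].
have [modU _ _] := simU.
have irrU : mx_irreducible (submod_repr modU) by apply/submod_mx_irr.
have hv := intertwines_val_submod modU.
have nzv : val_submod (1%:M : 'M_(\rank U)) != 0.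
  by rewrite val_submod_eq0; case: irrU.
have hB : intertwines I (submod_repr modU) phi (val_submod 1%:M *m ind_eval1 G phi).
  exact: intertwines_mulmx (intertwinesS sIG hv) (ind_eval1_intertwines _ _).
have nzB : val_submod 1%:M *m ind_eval1 G phi != 0 :> 'M_(\rank U, m).
  by apply: contraNneq nzv => /(ind_eval1_inj hv)->.
have [_ [_ [_ _ _ eq_rU _]]] :=
  isotypic_component_rsim irrU irr_phi phi_sigma hB nzB.
apply: mx_rsim_irr irrU; exists (val_submod 1%:M) => //.
  (* The simple submodule U has dimension |G : I| m, an upper bound for that of the induced module,
     so U is everything. *)
  apply/eqP; rewrite eqn_leq rank_leq_row /= -eq_rU.
  exact: (ind_space_rank sIG).
by rewrite /row_free val_submod1.
Qed.

Lemma ind_component m (phi : mx_representation F I m) :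
    mx_irreducible phi -> lies_over phi ->
  exists i, exists p, [/\ intertwines I phi (ind_repr sIG phi) i,
    intertwines I (ind_repr sIG phi) phi p, i *m p = 1%:M &
    forall X, intertwines N sigma (ind_repr sIG phi) X -> X *m p *m i = X].
Proof.
move=> irr_phi phi_sigma; have irrR := ind_irreducible irr_phi phi_sigma.
(* Otherwise [ind_eval1_inj], applied to the identity, would make the induced module zero. *)
have nz_ev : ind_eval1 G phi != 0.
  have [_ nz1 _] := irrR; apply: contraNneq nz1 => ev0.
  apply/eqP/(@ind_eval1_inj _ _ _ _ sIG _ phi _ (ind_repr sIG phi)).
    by move=> x _; rewrite mul1mx mulmx1.
  by rewrite ev0 mulmx0.
have [i [p [hi hp ip _ homr]]] := isotypic_component_rsim irrR irr_phi phi_sigma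
  (ind_eval1_intertwines sIG phi) nz_ev.
by exists i, p.
Qed.

(** Every N-map from sigma into the induced module lands in its component phi, so composing with [p]
    and with [i] gives injections both ways. *)
Lemma dimHom_ind_component m (phi : mx_representation F I m) :
    mx_irreducible phi -> lies_over phi ->
  inertia_index sNG sigma (ind_repr sIG phi) = inertia_index sNI sigma phi.
Proof.
move=> irr_phi phi_sigma.
have [i [p [hi hp ip homr]]] := ind_component irr_phi phi_sigma.
apply/eqP; rewrite eqn_leq; apply/andP; split.
  apply: (dimHom_le (f := mulmxr p)) => X hX /=.
    exact: intertwines_mulmx hX (intertwinesS sNI hp).
  by move=> Xp0; rewrite -(homr X hX) Xp0 mul0mx.
apply: (dimHom_le (f := mulmxr i)) => X hX /=.
  exact: intertwines_mulmx hX (intertwinesS sNI hi).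
by move=> Xi0; rewrite -[X]mulmx1 -ip mulmxA Xi0 mul0mx.
Qed.

Lemma ind_lies_over m (phi : mx_representation F I m) :
    mx_irreducible phi -> lies_over phi ->
  exists2 A, intertwines N sigma (ind_repr sIG phi) A & A != 0.
Proof.
move=> irr_phi phi_sigma.
have [i [p [hi hp ip homr]]] := ind_component irr_phi phi_sigma.
have [D hD nzD] := lies_over_sub irr_phi phi_sigma.
exists (D *m i); first exact: intertwines_mulmx hD (intertwinesS sNI hi).
by apply: contraNneq nzD => Di0; rewrite -[D]mulmx1 -ip mulmxA Di0 mul0mx.
Qed.

(** An isomorphism Q of the induced modules respects isotypic components. The map [i *m Q *m p']
    from phi to phi' is nonzero because it does not kill the image of a nonzero [D] from sigma to
    phi. *)
Lemma ind_inj m (phi : mx_representation F I m)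
    m' (phi' : mx_representation F I m') :
    mx_irreducible phi -> lies_over phi ->
    mx_irreducible phi' -> lies_over phi' ->
    mx_rsim (ind_repr sIG phi) (ind_repr sIG phi') ->
  mx_rsim phi phi'.
Proof.
move=> irr_phi phi_sigma irr_phi' phi'_sigma simR.
have [i [p [hi hp ip homr]]] := ind_component irr_phi phi_sigma.
have [i' [p' [hi' hp' ip' homr']]] := ind_component irr_phi' phi'_sigma.
have [Q [Q' [hQ hQ' QQ' Q'Q]]] := rsim_intertwines simR.
have [D hD nzD] := lies_over_sub irr_phi phi_sigma.
have hiQ : intertwines I phi (ind_repr sIG phi') (i *m Q).
  exact: intertwines_mulmx hi (intertwinesS sIG hQ).
have := homr' _ (intertwines_mulmx hD (intertwinesS sNI hiQ)).
move=> DiQ; apply: (intertwines_rsim (B := i *m Q *m p')) => //.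
  exact: intertwines_mulmx hiQ hp'.
apply: contraNneq nzD => iQp0; rewrite -[D]mulmx1 -ip -[i]mulmx1 -QQ'.
by rewrite !mulmxA -(mulmxA D) -DiQ -(mulmxA D) iQp0 mulmx0 !mul0mx.
Qed.

(** The preimage is the isotypic component of theta: reciprocity turns the retraction onto it into a
    nonzero G-map from theta to the induced module, and both are irreducible. *)
Lemma ind_surj n (theta : mx_representation F G n) :
    mx_irreducible theta ->
    (exists2 A, intertwines N sigma theta A & A != 0) ->
  exists phi : representation F I, [/\ mx_irreducible phi, lies_over phi &
    mx_rsim (ind_repr sIG phi) theta].
Proof.
move=> irr_theta /(isotypic_component_exists nsNG irr_sigma irr_theta).
case=> w rW e i p irrW hi hp ip _ _ _ simW.
have [w_gt0 _] := (mx_irrP rW).1 irrW.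
have e_gt0 : (0 < e)%N.
  case: e simW => // /mxrank_rsim; rewrite /muln_grepr big_ord0 /= => w0.
  by rewrite w0 in w_gt0.
have W_sigma : lies_over rW.
  apply/(dimHom_gt0P (subg_repr rW sNI)).
  rewrite (dimHom_rsim simW (mx_rsim_refl sigma)) dimHom_muln_l muln_gt0 e_gt0.
  apply/dimHom_gt0P; exists 1%:M => [x _|]; first by rewrite mulmx1 mul1mx.
  by case: irr_sigma.
exists (Representation rW); split=> //.
have [B hB nzB] : exists2 B, intertwines G theta (ind_repr sIG rW) B & B != 0.
  apply/ind_hom_neq0; exists p => //; have [_ nz1 _] := irrW.
  by apply: contraNneq nz1 => p0; rewrite -ip p0 mulmx0.
by apply: mx_rsim_sym (intertwines_rsim irr_theta (ind_irreducible _ _) hB nzB).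
Qed.

End CliffordCorrespondence.

(** * From equivalence classes to representatives *)

Section Classes.

Variables (F : fieldType) (gT : finGroupType) (N K : {group gT}).
Hypothesis sNK : N \subset K.
Variables (k : nat) (sigma : mx_representation F N k).

Lemma class_of_eqP (A B : representation F K) :
  class_of A = class_of B <-> mx_rsim A B.
Proof. by split=> [/eqP/class_ofP | /class_ofP/eqP]. Qed.

Lemma row_free_irr_neq0 m n (rV : mx_representation F K m) (B : 'M[F]_(m, n)) :
  mx_irreducible rV -> row_free B -> B != 0.
Proof. by move=> /mx_irrP[m_gt0 _] /eqP rB; rewrite -mxrank_eq0 rB -lt0n. Qed.

(** For irreducible phi a nonzero map to the induced module is an embedding, and reciprocity trades
    it for a nonzero N-map to sigma. *)
Lemma irr_indP (phi : representation F K) :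
  irr_ind sNK sigma (class_of phi) <-> mx_irreducible phi /\ lies_over sigma phi.
Proof.
split=> [[phi' [irr' /subreprP[B hB freeB]]] /class_of_eqP sim | [irr phi_sigma]].
  have irr := mx_rsim_irr sim irr'; split=> //.
  apply/(ind_hom_neq0 sNK).
  have [Q [Q' [hQ hQ' QQ' Q'Q]]] := rsim_intertwines sim.
  exists (Q' *m B); first exact: intertwines_mulmx hQ' hB.
  apply: contraNneq (row_free_irr_neq0 irr' freeB) => Q'B0.
  by rewrite -[B]mul1mx -QQ' -mulmxA Q'B0 mulmx0.
exists phi => //; split=> //; apply/subreprP.
have [B hB nzB] := (ind_hom_neq0 sNK sigma phi).2 phi_sigma.
by exists B => //; apply: intertwines_row_free irr hB nzB.
Qed.

Lemma irr_resP (theta : representation F K) : mx_irreducible sigma ->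
  irr_res sNK sigma (class_of theta) <->
  mx_irreducible theta /\ (exists2 A, intertwines N sigma theta A & A != 0).
Proof.
move=> irr_sigma; split=> [[theta' [irr' /subreprP[B hB freeB]]] | [irr [A hA nzA]]].
  move/class_of_eqP=> sim; have irr := mx_rsim_irr sim irr'; split=> //.
  have [Q [Q' [hQ hQ' QQ' Q'Q]]] := rsim_intertwines sim.
  exists (B *m Q); first exact: intertwines_mulmx hB (intertwinesS sNK hQ).
  have [_ nz1 _] := irr_sigma; have [B' BB'] := row_freeP freeB.
  apply: contraNneq nz1 => BQ0; rewrite -BB' -[B]mulmx1 -QQ' mulmxA BQ0.
  by rewrite !mul0mx.
exists theta => //; split=> //; apply/subreprP; exists A => //.
exact: (intertwines_row_free (rW := subg_repr theta sNK) irr_sigma hA nzA).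
Qed.

End Classes.

Theorem theorem1p8
    (F : closedFieldType) (p : nat) (pcharF : p \in [pchar F])
    (gT : finGroupType) (G N : {group gT}) (nsNG : (N <| G)%g)
    (p_dvd_N : (p %| #|N|)%N)
    (n : nat) (sigma : mx_representation F N n)
    (irr_sigma : mx_irreducible sigma) :
  let I := inertia sigma G in
  let sIG : I \subset G := inertia_sub sigma G in
  let sNI : N \subset I := sub_inertia sigma nsNG in
  let sNG : N \subset G := normal_sub nsNG in
  forall (s : seq (rclass F I)) (m : rclass F I -> nat),
    uniq s ->
    (forall c : rclass F I, c \in s <-> irr_ind sNI sigma c) ->
    mx_rsim (ind_repr sNI sigma)
      (\big[@dadd_grepr F gT I/@grepr0 F gT I]_(c <- s) muln_grepr (repr c) (m c)) ->
  set_bij (irr_ind sNI sigma) (irr_res sNG sigma) (ind_class sIG) /\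
  (forall phi : representation F I, irr_ind sNI sigma (class_of phi) ->
     [/\ inertia_index sNI sigma phi = m (class_of phi),
         inertia_index sNG sigma (ind_repr sIG phi) = m (class_of phi)
       & mx_rsim (subg_repr phi sNI)
           (muln_grepr (Representation sigma) (m (class_of phi)))]).
Proof.
move=> I sIG sNI sNG s m uniq_s s_ind sim_ind.
have indP (phi : representation F I) := irr_indP sNI sigma phi.
have resP (theta : representation F G) := irr_resP sNG theta irr_sigma.
split.
  split=> [c | c c' | t].
- rewrite -(class_of_repr c) => /indP[irr_phi phi_sigma].
  rewrite ind_class_of; apply/resP; split; first exact: ind_irreducible.
  exact: ind_lies_over.
- move=> /set_mem + /set_mem; rewrite -(class_of_repr c) -(class_of_repr c').
  move=> /indP[irr_c c_sigma] /indP[irr_c' c'_sigma].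
  rewrite !ind_class_of => /class_of_eqP simR; apply/class_of_eqP.
  exact: (ind_inj nsNG).
- rewrite -(class_of_repr t) => /resP[irr_t t_sigma].
  have [phi [irr_phi phi_sigma simR]] := ind_surj nsNG irr_sigma irr_t t_sigma.
  exists (class_of phi); first exact/indP.
  by rewrite ind_class_of; apply/class_of_eqP.
move=> phi /[dup] ind_phi /indP[irr_phi phi_sigma].
have [e sim_phi] := lies_over_multiple nsNG irr_sigma irr_phi phi_sigma.
have dim_sigma : dimHom sigma sigma = 1%N.
  by rewrite dimHom_irr // asboolT //; apply: mx_rsim_refl.
have idx_phi : inertia_index sNI sigma phi = e.
  rewrite /inertia_index (dimHom_rsim (mx_rsim_refl sigma) sim_phi).
  by rewrite dimHom_muln_r dim_sigma muln1.
have def_e : e = m (class_of phi).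
  (* This dimension is counted twice: reciprocity and the restriction of phi give e, while in the
     given decomposition of the induced module only the class of phi contributes, by its
     multiplicity. *)
  transitivity (dimHom phi (ind_repr sNI sigma)).
    rewrite dimHom_ind (dimHom_rsim sim_phi (mx_rsim_refl sigma)).
    by rewrite dimHom_muln_l dim_sigma muln1.
  rewrite (dimHom_rsim (mx_rsim_refl phi) sim_ind) dimHom_sum_r.
  have phi_s : class_of phi \in s by apply/s_ind.
  rewrite (bigD1_seq (class_of phi)) //= dimHom_muln_r dimHom_irr //; last first.
    by have /indP[] : irr_ind sNI sigma (class_of (repr (class_of phi)));
       rewrite ?class_of_repr.
  rewrite asboolT ?muln1; last by apply/class_of_eqP; rewrite class_of_repr.
  rewrite big_seq_cond big1 ?addn0 // => c /andP[/s_ind ind_c ne_c].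
  rewrite dimHom_muln_r dimHom_irr //; last first.
    by have /indP[] : irr_ind sNI sigma (class_of (repr c)); rewrite ?class_of_repr.
  rewrite asboolF ?muln0 // => /class_of_eqP; rewrite class_of_repr => eq_c.
  by rewrite eq_c eqxx in ne_c.
rewrite -def_e; split=> //.
by rewrite (dimHom_ind_component nsNG irr_sigma irr_phi phi_sigma).
Qed.
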